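(* The kernel of $\rho_1$ is contained in the commutator subgroup of $\Gamma$, as a normal subgroup: $\mathrm{Ker}(\rho_1)\lhd[\Gamma,\Gamma]$.
   Context: Commutators are $[x,y]=xyx^{-1}y^{-1}$. $\Gamma=\langle g_1,g_3\mid [g_3,g_1^{-1}]g_3=g_1[g_3,g_1^{-1}]\rangle$ is the fundamental group of the figure eight knot complement. $\mathbf{PU}(2,1)$ is the image in $PGL_3(\mathbb{C})$ of the group of matrices preserving the Hermitian form $\langle Z,W\rangle=Z_1\overline{W}_3+Z_2\overline{W}_2+Z_3\overline{W}_1$. The representation $\rho_1:\Gamma\to\mathbf{PU}(2,1)$ is given by (the projective classes of) $$\rho_1(g_1)=\begin{pmatrix}1&1&-\frac12-\frac{\sqrt3}{2}i\\0&1&-1\\0&0&1\end{pmatrix},\qquad \rho_1(g_3)=\begin{pmatrix}1&0&0\\1&1&0\\-\frac12-\frac{\sqrt3}{2}i&-1&1\end{pmatrix}.$$ *)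

(* Defs.v *)
From HB Require Import structures.
From mathcomp Require Import all_boot all_order all_algebra.
From mathcomp Require Import boolp classical_sets reals.
From mathcomp Require Import complex ring.

Set Implicit Arguments.
Unset Strict Implicit.
Unset Printing Implicit Defensive.

Import Order.TTheory GRing.Theory Num.Theory.

Local Open Scope classical_set_scope.
Local Open Scope quotient_scope.
Local Open Scope group_scope.

Section Subgroups.
Variable G : groupType.
Implicit Types (S K H : set G) (x y : G).

Definition is_subgroup S : Prop := group_closed (mem S).

Lemma is_subgroupP S : is_subgroup S <->
  [/\ S 1, forall x y, S x -> S y -> S (x * y) & forall x, S x -> S x^-1].
Proof.
split=> [[S1 SF]|[S1 SM SV]].
  have {}S1 : S 1 by apply: set_mem.
  have {}SF x y : S x -> S y -> S (x / y).
    by move=> Sx Sy; apply/set_mem/SF; apply: mem_set.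
  have SV x : S x -> S x^-1 by rewrite -[x^-1]mul1g; apply: SF.
  by split=> // x y Sx Sy; rewrite -[y]invgK; apply: SF => //; apply: SV.
split=> [|x y /set_mem Sx /set_mem Sy]; apply/mem_set => //.
by apply: SM => //; apply: SV.
Qed.

Definition generated S : set G := smallest is_subgroup S.

Definition normal_in K H : Prop :=
  [/\ is_subgroup K, is_subgroup H, K `<=` H
    & forall h k, H h -> K k -> K (h * k * h^-1)].

(* This is [~ x^-1, y^-1] for the library's [~ x, y] = x^-1 * y^-1 * x * y. *)
Definition comm x y : G := x * y * x^-1 * y^-1.

Definition comm_subgroup : set G :=
  generated [set z | exists x y, z = comm x y].

End Subgroups.

Arguments comm_subgroup G : clear implicits.

Definition kernel (G H : groupType) (f : {multiplicative G -> H}) : set G :=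
  [set x | f x = 1].

(* The group <X | r.1 = r.2 for r in rels>: words in the letters (x, false),
   standing for x, and (x, true), standing for x^-1, modulo the congruence
   generated by the free cancellations and the relations. *)
Section PresentedGroup.
Variable X : choiceType.

Definition word := seq (X * bool).

Implicit Types u v w : word.

Definition wgen (x : X) : word := [:: (x, false)].
Definition winv w : word := rev [seq (l.1, ~~ l.2) | l <- w].
Definition wcomm u v : word := u ++ v ++ winv u ++ winv v.

Variable rels : seq (word * word).

Inductive wcong : word -> word -> Prop :=
| wcong_refl w : wcong w w
| wcong_sym u v : wcong u v -> wcong v u
| wcong_trans u v w : wcong u v -> wcong v w -> wcong u w
| wcong_cancel u v x b : wcong (u ++ (x, b) :: (x, ~~ b) :: v) (u ++ v)
| wcong_rel u v r : r \in rels -> wcong (u ++ r.1 ++ v) (u ++ r.2 ++ v).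

Lemma wcong_cat u u' v v' :
  wcong u u' -> wcong v v' -> wcong (u ++ v) (u' ++ v').
Proof.
have catl a b c : wcong a b -> wcong (c ++ a) (c ++ b).
  elim=> {a b} [w|a b _ ?|a b d _ H1 _ H2|a b x e|a b r rP].
  - exact: wcong_refl.
  - exact: wcong_sym.
  - exact: wcong_trans H1 H2.
  - by rewrite !catA; apply: wcong_cancel.
  - by rewrite !(catA c); apply: wcong_rel.
have catr a b c : wcong a b -> wcong (a ++ c) (b ++ c).
  elim=> {a b} [w|a b _ ?|a b d _ H1 _ H2|a b x e|a b r rP].
  - exact: wcong_refl.
  - exact: wcong_sym.
  - exact: wcong_trans H1 H2.
  - by rewrite -!catA !cat_cons; apply: wcong_cancel.
  - by rewrite -!catA; apply: wcong_rel.
by move=> uu' vv'; apply: wcong_trans (catr _ _ _ uu') (catl _ _ _ vv').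
Qed.

Lemma winvK : involutive winv.
Proof.
move=> w; rewrite /winv map_rev revK -map_comp -[RHS]map_id.
by apply: eq_map => -[x b] /=; rewrite negbK.
Qed.

Lemma winv_cat u v : winv (u ++ v) = winv v ++ winv u.
Proof. by rewrite /winv map_cat rev_cat. Qed.

Lemma wcong_mulV w : wcong (w ++ winv w) [::].
Proof.
elim/last_ind: w => [|w [x b] IH]; first exact: wcong_refl.
rewrite -cats1 winv_cat -catA; apply: wcong_trans IH.
exact: wcong_cancel.
Qed.

Lemma wcong_mulN w : wcong (winv w ++ w) [::].
Proof. by rewrite -{2}(winvK w); apply: wcong_mulV. Qed.

Lemma wcong_inv u v : wcong u v -> wcong (winv u) (winv v).
Proof.
move=> uv.
have H1 : wcong (winv u ++ (v ++ winv v)) (winv u).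
  by rewrite -{2}[winv u]cats0; apply/wcong_cat/wcong_mulV/wcong_refl.
have H2 : wcong (winv u ++ (v ++ winv v)) (winv u ++ (u ++ winv v)).
  apply: wcong_cat; first exact: wcong_refl.
  by apply: wcong_cat; [apply: wcong_sym|apply: wcong_refl].
apply: wcong_trans (wcong_sym H1) _; apply: wcong_trans H2 _.
rewrite catA -{2}[winv v]cat0s.
by apply: wcong_cat; [apply: wcong_mulN|apply: wcong_refl].
Qed.

Definition wcongb : rel word := fun u v => `[< wcong u v >].

Fact wcongb_refl : reflexive wcongb.
Proof. by move=> w; apply/asboolP/wcong_refl. Qed.
Fact wcongb_sym : symmetric wcongb.
Proof. by move=> u v; apply/asboolP/asboolP; apply: wcong_sym. Qed.
Fact wcongb_trans : transitive wcongb.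
Proof.
by move=> v u w /asboolP uv /asboolP vw; apply/asboolP/(wcong_trans uv).
Qed.
Canonical wcong_equiv := EquivRel wcongb wcongb_refl wcongb_sym wcongb_trans.

Definition presented := {eq_quot wcong_equiv}.

HB.instance Definition _ := Choice.on presented.

Definition pclass w : presented := \pi_presented w.
Definition pword (x : presented) : word := repr x.

Lemma pwordK : cancel pword pclass.
Proof. exact: reprK. Qed.

Lemma pclassP u v : pclass u = pclass v <-> wcong u v.
Proof.
split=> [/eqP|uv]; first by rewrite piE => /asboolP.
by apply/eqP; rewrite piE; apply/asboolP.
Qed.

Lemma pword_class w : wcong (pword (pclass w)) w.
Proof. by apply/pclassP; rewrite pwordK. Qed.

Definition pmul (x y : presented) : presented := pclass (pword x ++ pword y).
Definition pinv (x : presented) : presented := pclass (winv (pword x)).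

Lemma pmulE u v : pmul (pclass u) (pclass v) = pclass (u ++ v).
Proof. by apply/pclassP/wcong_cat; apply: pword_class. Qed.

Lemma pinvE w : pinv (pclass w) = pclass (winv w).
Proof. by apply/pclassP/wcong_inv/pword_class. Qed.

Fact pmulA : associative pmul.
Proof.
move=> x y z; rewrite -[x]pwordK -[y]pwordK -[z]pwordK.
by rewrite !pmulE catA.
Qed.
Fact p1mul : left_id (pclass [::]) pmul.
Proof. by move=> x; rewrite -[x]pwordK pmulE. Qed.
Fact pmul1 : right_id (pclass [::]) pmul.
Proof. by move=> x; rewrite -[x]pwordK pmulE cats0. Qed.
Fact pVmul : left_inverse (pclass [::]) pinv pmul.
Proof.
by move=> x; rewrite -[x]pwordK pinvE pmulE; apply/pclassP/wcong_mulN.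
Qed.
Fact pmulV : right_inverse (pclass [::]) pinv pmul.
Proof.
by move=> x; rewrite -[x]pwordK pinvE pmulE; apply/pclassP/wcong_mulV.
Qed.

HB.instance Definition _ :=
  isGroup.Build presented pmulA p1mul pmul1 pVmul pmulV.

Lemma pclassM u v : pclass (u ++ v) = pclass u * pclass v.
Proof. by rewrite -pmulE. Qed.

Lemma pclassV w : pclass (winv w) = (pclass w)^-1.
Proof. by rewrite -pinvE. Qed.

Lemma pclass_comm u v : pclass (wcomm u v) = comm (pclass u) (pclass v).
Proof. by rewrite /wcomm !pclassM !pclassV /comm !mulgA. Qed.

Section Lift.
Variables (H : groupType) (f : X -> H).

Definition weval w : H := \prod_(l <- w) (if l.2 then (f l.1)^-1 else f l.1).

Lemma weval_cat u v : weval (u ++ v) = weval u * weval v.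
Proof. exact: big_cat. Qed.

Lemma weval_gen x : weval (wgen x) = f x.
Proof. by rewrite /weval big_seq1. Qed.

Lemma weval_inv w : weval (winv w) = (weval w)^-1.
Proof.
elim: w => [|[x b] w IH]; first by rewrite /weval !big_nil invg1.
rewrite -cat1s winv_cat !weval_cat IH invgM; congr (_ * _).
by rewrite /weval !big_seq1 /=; case: b; rewrite ?invgK.
Qed.

Lemma weval_comm u v : weval (wcomm u v) = comm (weval u) (weval v).
Proof. by rewrite !weval_cat !weval_inv /comm !mulgA. Qed.

Hypothesis fP : {in rels, forall r, weval r.1 = weval r.2}.

Lemma weval_cong u v : wcong u v -> weval u = weval v.
Proof.
elim=> {u v} [w|u v _ ->|u v w _ -> _ ->|u v x b|u v r /fP rP] //.
- have c : weval [:: (x, b)] * weval [:: (x, ~~ b)] = 1.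
    by rewrite /weval !big_seq1 /=; case: b; rewrite ?mulgV ?mulVg.
  rewrite -cat1s -(cat1s (x, ~~ b)) !weval_cat.
  by rewrite (mulgA (weval [:: (x, b)])) c mul1g.
- by rewrite !weval_cat rP.
Qed.

Definition plift of {in rels, forall r, weval r.1 = weval r.2} :=
  fun x : presented => weval (pword x).

Lemma plift_class w : plift fP (pclass w) = weval w.
Proof. exact/weval_cong/pword_class. Qed.

Lemma plift_gen x : plift fP (pclass (wgen x)) = f x.
Proof. by rewrite plift_class weval_gen. Qed.

Fact plift_mul : {morph plift fP : x y / x * y}.
Proof.
move=> x y; rewrite -[x]pwordK -[y]pwordK -pclassM !plift_class.
exact: weval_cat.
Qed.

HB.instance Definition _ := isMultiplicative.Build presented H (plift fP) plift_mul.

End Lift.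
End PresentedGroup.

Variant knot_gen := G1 | G3.

Definition knot_gen_bool g := if g is G1 then false else true.
Definition bool_knot_gen b := if b then G3 else G1.
Fact knot_gen_boolK : cancel knot_gen_bool bool_knot_gen.
Proof. by case. Qed.
HB.instance Definition _ := Choice.copy knot_gen (can_type knot_gen_boolK).

Definition knot_relation : word knot_gen * word knot_gen :=
  let c := wcomm (wgen G3) (winv (wgen G1)) in
  (c ++ wgen G3, wgen G1 ++ c).

Definition Gamma := presented [:: knot_relation].

HB.instance Definition _ := Group.on Gamma.

Definition g1 : Gamma := pclass _ (wgen G1).
Definition g3 : Gamma := pclass _ (wgen G3).

Lemma Gamma_relation : comm g3 g1^-1 * g3 = g1 * comm g3 g1^-1.
Proof.
have /pclassP := @wcong_rel _ _ [::] [::] _ (mem_head knot_relation [::]).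
by rewrite !cat0s !cats0 [LHS]pclassM [RHS]pclassM !pclass_comm !pclassV.
Qed.

Section PGL.
Variables (F : fieldType) (n : nat).
Local Open Scope ring_scope.

Record GL := mkGL { GLmx :> 'M[F]_n; GLmxP : GLmx \in unitmx }.

HB.instance Definition _ := [isSub for GLmx].
HB.instance Definition _ := [Choice of GL by <:].

Definition GLmul (A B : GL) : GL :=
  mkGL (etrans (unitmx_mul A B) (andb_true_intro (conj (GLmxP A) (GLmxP B)))).
Definition GL1 : GL := mkGL (unitmx1 F n).
Definition GLinv (A : GL) : GL := mkGL (etrans (unitmx_inv A) (GLmxP A)).

Fact GLmulA : associative GLmul.
Proof. by move=> A B C; apply/val_inj/mulmxA. Qed.
Fact GL1mul : left_id GL1 GLmul.
Proof. by move=> A; apply/val_inj/mul1mx. Qed.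
Fact GLmul1 : right_id GL1 GLmul.
Proof. by move=> A; apply/val_inj/mulmx1. Qed.
Fact GLVmul : left_inverse GL1 GLinv GLmul.
Proof. by move=> A; apply/val_inj/mulVmx/GLmxP. Qed.
Fact GLmulV : right_inverse GL1 GLinv GLmul.
Proof. by move=> A; apply/val_inj/mulmxV/GLmxP. Qed.

HB.instance Definition _ :=
  isGroup.Build GL GLmulA GL1mul GLmul1 GLVmul GLmulV.

Lemma GLmxM (A B : GL) : GLmx (A * B)%g = GLmx A *m GLmx B.
Proof. by []. Qed.

Lemma GLmxV (A : GL) : GLmx A^-1%g = invmx (GLmx A).
Proof. by []. Qed.

Definition proj_eq (A B : GL) : Prop :=
  exists2 c : F, c != 0 & GLmx A = c *: GLmx B.

Definition proj_eqb : rel GL := fun A B => `[< proj_eq A B >].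

Fact proj_eqb_refl : reflexive proj_eqb.
Proof. by move=> A; apply/asboolP; exists 1; rewrite ?oner_neq0 ?scale1r. Qed.
Fact proj_eqb_sym : symmetric proj_eqb.
Proof.
by move=> A B; apply/asboolP/asboolP => -[c c0 E]; exists c^-1;
  rewrite ?invr_eq0 ?E ?scalerA ?mulVf ?scale1r.
Qed.
Fact proj_eqb_trans : transitive proj_eqb.
Proof.
move=> B A C /asboolP[c c0 AB] /asboolP[d d0 BC]; apply/asboolP.
by exists (c * d); rewrite ?mulf_neq0 // AB BC scalerA.
Qed.
Canonical proj_equiv :=
  EquivRel proj_eqb proj_eqb_refl proj_eqb_sym proj_eqb_trans.

Definition PGL := {eq_quot proj_equiv}.

HB.instance Definition _ := Choice.on PGL.

Definition proj (A : GL) : PGL := \pi_PGL A.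
Definition lift_GL (x : PGL) : GL := repr x.

Lemma lift_GLK : cancel lift_GL proj.
Proof. exact: reprK. Qed.

Lemma projP A B : proj A = proj B <-> proj_eq A B.
Proof.
split=> [/eqP|AB]; first by rewrite piE => /asboolP.
by apply/eqP; rewrite piE; apply/asboolP.
Qed.

Definition PGLmul (x y : PGL) : PGL := proj (lift_GL x * lift_GL y)%g.
Definition PGLinv (x : PGL) : PGL := proj (lift_GL x)^-1%g.

Lemma PGLmulE A B : PGLmul (proj A) (proj B) = proj (A * B)%g.
Proof.
have /projP[c c0 E] := lift_GLK (proj A).
have /projP[d d0 E'] := lift_GLK (proj B).
apply/projP; exists (c * d); first by rewrite mulf_neq0.
by rewrite /= E E' -scalemxAl -scalemxAr scalerA.
Qed.

Lemma PGLinvE A : PGLinv (proj A) = proj A^-1%g.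
Proof.
have /projP[c c0 E] := lift_GLK (proj A).
apply/projP; exists c^-1; first by rewrite invr_eq0.
by rewrite /= E invmxZ ?unitfE // -E GLmxP.
Qed.

Fact PGLmulA : associative PGLmul.
Proof.
move=> x y z; rewrite -[x]lift_GLK -[y]lift_GLK -[z]lift_GLK.
by rewrite !PGLmulE mulgA.
Qed.
Fact PGL1mul : left_id (proj 1%g) PGLmul.
Proof. by move=> x; rewrite -[x]lift_GLK PGLmulE mul1g. Qed.
Fact PGLmul1 : right_id (proj 1%g) PGLmul.
Proof. by move=> x; rewrite -[x]lift_GLK PGLmulE mulg1. Qed.
Fact PGLVmul : left_inverse (proj 1%g) PGLinv PGLmul.
Proof. by move=> x; rewrite -[x]lift_GLK PGLinvE PGLmulE mulVg. Qed.
Fact PGLmulV : right_inverse (proj 1%g) PGLinv PGLmul.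
Proof. by move=> x; rewrite -[x]lift_GLK PGLinvE PGLmulE mulgV. Qed.

HB.instance Definition _ :=
  isGroup.Build PGL PGLmulA PGL1mul PGLmul1 PGLVmul PGLmulV.

Lemma projM A B : proj (A * B)%g = (proj A * proj B)%g.
Proof. by rewrite -PGLmulE. Qed.

Lemma projV A : proj A^-1%g = ((proj A)^-1)%g.
Proof. by rewrite -PGLinvE. Qed.

End PGL.

Section PU21.
Variable R : realType.
Local Open Scope ring_scope.
Local Notation C := R[i].

(* Coordinates are numbered from 0. *)
Definition herm (Z W : 'cV[C]_3) : C :=
  Z 0 0 * (W 2 0)^* + Z 1 0 * (W 1 0)^* + Z 2 0 * (W 0 0)^*.

Definition preserves_herm (A : 'M[C]_3) : Prop :=
  forall Z W, herm (A *m Z) (A *m W) = herm Z W.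

Definition in_PU21 : {pred PGL C 3} :=
  [pred x | `[< exists2 A : GL C 3, preserves_herm A & proj A = x >]].

Fact in_PU21_group : group_closed in_PU21.
Proof.
split; first by apply/asboolP; exists 1%g => // Z W; rewrite !mul1mx.
move=> x y /asboolP[A hA <-] /asboolP[B hB <-]; apply/asboolP.
exists (A * B^-1)%g; last by rewrite projM projV.
move=> Z W; rewrite /= -!mulmxA hA.
by rewrite -hB !mulmxA mulmxV ?GLmxP // !mul1mx.
Qed.

Record PU21 := mkPU21 { PU21val :> PGL C 3; PU21valP : PU21val \in in_PU21 }.

HB.instance Definition _ := [isSub for PU21val].
HB.instance Definition _ := [Choice of PU21 by <:].
HB.instance Definition _ :=
  SubChoice_isSubGroup.Build _ _ PU21 in_PU21_group.

Definition mx3 (rows : seq (seq C)) : 'M[C]_3 :=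
  \matrix_(i < 3, j < 3) (nth [::] rows i)`_j.

Definition omegab : C := (- 2^-1 -i* (Num.sqrt 3 / 2))%C.

Definition rho1_mx (g : knot_gen) : 'M[C]_3 :=
  match g with
  | G1 => mx3 [:: [:: 1; 1; omegab];
                  [:: 0; 1; - 1];
                  [:: 0; 0; 1]]
  | G3 => mx3 [:: [:: 1; 0; 0];
                  [:: 1; 1; 0];
                  [:: omegab; - 1; 1]]
  end.

Definition rho1_mxV (g : knot_gen) : 'M[C]_3 :=
  match g with
  | G1 => mx3 [:: [:: 1; - 1; - 1 - omegab];
                  [:: 0; 1; 1];
                  [:: 0; 0; 1]]
  | G3 => mx3 [:: [:: 1; 0; 0];
                  [:: - 1; 1; 0];
                  [:: - 1 - omegab; 1; 1]]
  end.

Lemma omegab_conj : omegab^* = - 1 - omegab.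
Proof.
apply/eqP; rewrite eq_complex /=; apply/andP; split; apply/eqP; last by ring.
by field.
Qed.

Lemma omegab_sqr : omegab ^+ 2 = - 1 - omegab.
Proof.
have s3 : Num.sqrt (3 : R) ^+ 2 = 3 by rewrite sqr_sqrtr // ler0n.
apply/eqP; rewrite expr2 eq_complex /=; apply/andP; split; apply/eqP.
- by field: s3.
- by field: s3.
Qed.

Lemma sum3 (F : 'I_3 -> C) : \sum_i F i = F 0 + F 1 + F 2.
Proof.
rewrite !big_ord_recl big_ord0 addr0 addrA.
by congr (F _ + F _ + F _); apply/val_inj.
Qed.

Lemma forall3 (P : 'I_3 -> Prop) : P 0 -> P 1 -> P 2 -> forall i, P i.
Proof.
move=> P0 P1 P2 [[|[|[|]]] // ?];
  [move: P0|move: P1|move: P2]; congr P; exact/val_inj.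
Qed.

Lemma rho1_mxK g : rho1_mx g *m rho1_mxV g = 1%:M.
Proof.
by case: g; apply/matrixP; apply: forall3; apply: forall3;
  rewrite !mxE sum3 !mxE /=; ring.
Qed.

Lemma rho1_unit g : rho1_mx g \in unitmx.
Proof. by have [] := mulmx1_unit (rho1_mxK g). Qed.

Lemma rho1_invmx g : invmx (rho1_mx g) = rho1_mxV g.
Proof. by rewrite -[LHS]mulmx1 -(rho1_mxK g) mulKmx ?rho1_unit. Qed.

Lemma rho1_herm g : preserves_herm (rho1_mx g).
Proof.
have cD (x y : C) : (x + y)^* = x^* + y^* by apply: rmorphD.
have cM (x y : C) : (x * y)^* = x^* * y^* by apply: rmorphM.
have c0 : (0 : C)^* = 0 by apply: rmorph0.
have c1 : (1 : C)^* = 1 by apply: rmorph1.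
have cN1 : (- 1 : C)^* = - 1 by rewrite -[RHS]/(- (1)) -[in RHS]c1; apply: rmorphN.
by case: g => Z W; rewrite /herm !mxE !sum3 !mxE /=;
  rewrite !(cD, cM, c0, c1, cN1, omegab_conj); ring.
Qed.

Definition rho1_GL (g : knot_gen) : GL C 3 := mkGL (rho1_unit g).

Fact rho1_in_PU21 g : proj (rho1_GL g) \in in_PU21.
Proof. by apply/asboolP; exists (rho1_GL g) => //; apply: rho1_herm. Qed.

Definition rho1_gen (g : knot_gen) : PU21 := mkPU21 (rho1_in_PU21 g).

Lemma rho1_mx_relation
    (K := rho1_mx G3 *m rho1_mxV G1 *m rho1_mxV G3 *m rho1_mx G1) :
  K *m rho1_mx G3 = rho1_mx G1 *m K.
Proof.
have PE : rho1_mx G3 *m rho1_mxV G1 =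
    mx3 [:: [:: 1; - 1; - 1 - omegab];
            [:: 1; 0; - omegab];
            [:: omegab; - 1 - omegab; 1]].
  by apply/matrixP; apply: forall3; apply: forall3;
    rewrite !mxE sum3 !mxE /=; ring: omegab_sqr.
have QE : rho1_mxV G3 *m rho1_mx G1 =
    mx3 [:: [:: 1; 1; omegab];
            [:: - 1; 0; - 1 - omegab];
            [:: - 1 - omegab; - omegab; 1]].
  by apply/matrixP; apply: forall3; apply: forall3;
    rewrite !mxE sum3 !mxE /=; ring: omegab_sqr.
have -> : K = mx3 [:: [:: 2 + omegab; 0; omegab];
                      [:: 0; - omegab; 0];
                      [:: omegab; 0; 0]].
  rewrite /K -mulmxA PE QE.
  by apply/matrixP; apply: forall3; apply: forall3;
    rewrite !mxE sum3 !mxE /=; ring: omegab_sqr.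
by apply/matrixP; apply: forall3; apply: forall3;
  rewrite !mxE !sum3 !mxE /=; ring: omegab_sqr.
Qed.

Lemma rho1_GL_relation :
  (comm (rho1_GL G3) (rho1_GL G1)^-1 * rho1_GL G3 =
   rho1_GL G1 * comm (rho1_GL G3) (rho1_GL G1)^-1)%g.
Proof.
by rewrite /comm invgK; apply/val_inj;
  rewrite [LHS]GLmxM [RHS]GLmxM !GLmxM !GLmxV !rho1_invmx rho1_mx_relation.
Qed.

Fact rho1_relation :
  {in [:: knot_relation], forall r, weval rho1_gen r.1 = weval rho1_gen r.2}.
Proof.
move=> r; rewrite inE => /eqP->.
rewrite [LHS]weval_cat [RHS]weval_cat !weval_comm !weval_inv !weval_gen.
have := congr1 (@proj _ _) rho1_GL_relation.
rewrite /comm !(projM, projV) => E; apply/val_inj.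
exact: E.
Qed.

Definition rho1 : {multiplicative Gamma -> PU21} := plift rho1_relation.

Lemma rho1_g1 : PU21val (rho1 g1) = proj (rho1_GL G1).
Proof. by rewrite /= plift_gen. Qed.

Lemma rho1_g3 : PU21val (rho1 g3) = proj (rho1_GL G3).
Proof. by rewrite /= plift_gen. Qed.

End PU21.

(* Main.v *)
(** Put T(b, x) = [[1, - b^*, x], [0, 1, b], [0, 0, 1]] for Eisenstein integers
    with x + x^* = - b b^*, and let J be the antidiagonal involution; then
    rho_1(g_1) = T(-1, omegab) and rho_1(g_3) = J rho_1(g_1) J.  On words in
    the T(b, x), J and cube roots of unity, let f be the sum of the b's.
    Words for the generators g_1 and g_3 both have f = -1, so it is enough
    that f vanishes on every word with scalar value: the exponent sum is then
    trivial on the kernel, and it identifies the abelianization of Gamma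
    with Z.

    The prefixes of a word move the cusp at infinity along a path of cusps,
    consecutive ones being adjacent; the height of a cusp is the norm of the
    corner entry of the prefix.  The relation [triangle] pushes the path over
    three mutually adjacent cusps without changing f.  All cusps of maximal
    height can be pushed down: seen from such a cusp, its neighbours are the
    integral points of the Heisenberg group, the lower ones are those in an
    open Cygan ball of radius 1, and these are connected through adjacent
    points at Cygan distance 1.  A path of height 0 is constant, its word is
    a single T(b, x) up to a scalar, and f = b is read off its entries. *)
Require Import Defs.
From mathcomp Require Import all_boot all_order all_algebra.
From mathcomp Require Import classical_sets reals complex ring lra zify.

Set Implicit Arguments.
Unset Strict Implicit.
Unset Printing Implicit Defensive.

Import Order.TTheory GRing.Theory Num.Theory.

Local Open Scope ring_scope.

(** * Planar estimates *)

Section CyganGeometry.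
Variable R : realFieldType.
Implicit Types d v u : R.

(* By Lagrange's identity and 2 t < - r for t = d . u, the two summands are at
   most 2 - r^2/2 and 2 r - r^2/2, and these add up to 3 - (r - 1)^2. *)
Lemma edge_bound d1 d2 v1 v2 u1 u2 (r := d1 ^+ 2 + d2 ^+ 2) :
  2 * v1 = - r -> v1 ^+ 2 + v2 ^+ 2 <= 1 -> u1 ^+ 2 + u2 ^+ 2 = 1 ->
  (d1 + u1) ^+ 2 + (d2 + u2) ^+ 2 < 1 ->
  2 * v2 ^+ 2 + 2 * (d1 * u2 - d2 * u1) ^+ 2 <= 3.
Proof.
move=> v1E v_le u_unit Du.
have r_ge0 : 0 <= r by rewrite addr_ge0 ?sqr_ge0.
pose t := d1 * u1 + d2 * u2.
have t_lt : 2 * t < - r by rewrite /t /r; lra.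
have t_sq : r ^+ 2 <= 4 * t ^+ 2 by nra.
have lagrange : (d1 * u2 - d2 * u1) ^+ 2 = r - t ^+ 2.
  rewrite -[r]mulr1 -u_unit /r /t; ring.
have v1_sq : 4 * v1 ^+ 2 = r ^+ 2 by rewrite -[r ^+ 2]sqrrN -v1E; ring.
have := sqr_ge0 (r - 1); rewrite lagrange; lra.
Qed.

(* The first square below is |d + u|^4 / 4; the second one is at most 3/4 when
   k has the sign opposite to v2 - Im (d^* u), whose square is at most 3. *)
Lemma edge_exists d1 d2 v1 v2 u1 u2 h (r := d1 ^+ 2 + d2 ^+ 2) :
  2 * v1 = - r -> v1 ^+ 2 + v2 ^+ 2 <= 1 -> u1 ^+ 2 + u2 ^+ 2 = 1 ->
  (d1 + u1) ^+ 2 + (d2 + u2) ^+ 2 < 1 -> 4 * h ^+ 2 = 3 ->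
  exists2 k, k = h \/ k = - h &
   (v1 - 2^-1 - (d1 * u1 + d2 * u2)) ^+ 2 + (v2 + k - (d1 * u2 - d2 * u1)) ^+ 2 < 1.
Proof.
move=> v1E v_le u_unit Du hE.
have bnd := edge_bound v1E v_le u_unit Du.
have -> : v1 - 2^-1 - (d1 * u1 + d2 * u2) =
   - ((d1 + u1) ^+ 2 + (d2 + u2) ^+ 2) / 2.
  by move: v1E; rewrite /r; lra.
set rho := _ + _ in Du *.
have rho_ge0 : 0 <= rho by rewrite addr_ge0 ?sqr_ge0.
set tau := d1 * u2 - d2 * u1 in bnd *.
have mu_sq : (v2 - tau) ^+ 2 <= 3 by have := sqr_ge0 (v2 + tau); lra.
have rho_sq : (- rho / 2) ^+ 2 < 4^-1 by nra.
have sq k : k ^+ 2 = h ^+ 2 ->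
    (v2 + k - tau) ^+ 2 = (v2 - tau) ^+ 2 + 2 * (v2 - tau) * k + h ^+ 2.
  by move=> <-; ring.
have key : ((v2 - tau) ^+ 2 <= 2 * (v2 - tau) * h) \/
    ((v2 - tau) ^+ 2 <= - (2 * (v2 - tau) * h)).
  have le4 : ((v2 - tau) ^+ 2) ^+ 2 <= (2 * (v2 - tau) * h) ^+ 2.
    have -> : (2 * (v2 - tau) * h) ^+ 2 = (v2 - tau) ^+ 2 * (4 * h ^+ 2) by ring.
    by rewrite hE expr2 ler_wpM2l ?sqr_ge0.
  case: (lerP 0 (2 * (v2 - tau) * h)) => [hh|/ltW hh]; [left|right].
    by rewrite -ler_sqr ?nnegrE ?sqr_ge0.
  by rewrite -ler_sqr ?nnegrE ?sqr_ge0 ?oppr_ge0 // sqrrN.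
case: key => key; [exists (- h); first by right|exists h; first by left];
  rewrite sq ?sqrrN //; lra.
Qed.

(** By [edge_bound] at both ends of the vertical segment, v2 - tau and v2 + 2 h - tau have absolute
    value at most sqrt 3 = 2 |h|, where tau = Im (d^* u); hence their mean v2 + h - tau has absolute
    value at most |h|. *)
Lemma middle_strict d1 d2 v1 v2 u1 u2 h (r := d1 ^+ 2 + d2 ^+ 2) :
  2 * v1 = - r -> v1 ^+ 2 + v2 ^+ 2 <= 1 -> v1 ^+ 2 + (v2 + 2 * h) ^+ 2 <= 1 ->
  u1 ^+ 2 + u2 ^+ 2 = 1 ->
  (d1 + u1) ^+ 2 + (d2 + u2) ^+ 2 < 1 -> 4 * h ^+ 2 = 3 ->
   (v1 - 2^-1 - (d1 * u1 + d2 * u2)) ^+ 2 + (v2 + h - (d1 * u2 - d2 * u1)) ^+ 2 < 1.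
Proof.
move=> v1E v_le v_le' u_unit Du hE.
have bnd := edge_bound v1E v_le u_unit Du.
have bnd' := edge_bound v1E v_le' u_unit Du.
have -> : v1 - 2^-1 - (d1 * u1 + d2 * u2) =
   - ((d1 + u1) ^+ 2 + (d2 + u2) ^+ 2) / 2.
  by move: v1E; rewrite /r; lra.
set rho := _ + _ in Du *.
have rho_ge0 : 0 <= rho by rewrite addr_ge0 ?sqr_ge0.
set tau := d1 * u2 - d2 * u1 in bnd bnd' *.
have rho_sq : (- rho / 2) ^+ 2 < 4^-1 by nra.
suff : (v2 + h - tau) ^+ 2 <= h ^+ 2 by lra.
have e1 : (v2 - tau) ^+ 2 <= 3 by have := sqr_ge0 (v2 + tau); lra.
have e2 : (v2 + 2 * h - tau) ^+ 2 <= 3 by have := sqr_ge0 (v2 + 2 * h + tau); lra.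
have e3 : (v2 + tau) ^+ 2 <= 3 by have := sqr_ge0 (v2 - tau); lra.
have e4 : (v2 + 2 * h + tau) ^+ 2 <= 3 by have := sqr_ge0 (v2 + 2 * h - tau); lra.
nra.
Qed.

(* For s = sqrt 3 the six summands are the numbers 2 Re (d^* u) for the six
   units u of the Eisenstein integers. *)
Lemma unit_step d1 d2 s (r := d1 ^+ 2 + d2 ^+ 2) : s ^+ 2 = 3 ->
  r != 0 -> r <= 2 ->
  [\/ r + 2 * d1 < 0, r - 2 * d1 < 0, r + (d1 + s * d2) < 0 |
   [\/ r - (d1 + s * d2) < 0, r + (d1 - s * d2) < 0 | r - (d1 - s * d2) < 0]].
Proof.
move=> sE r0 r2.
have r_gt0 : 0 < r by rewrite lt_def r0 addr_ge0 ?sqr_ge0.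
have E : (2 * d1) ^+ 2 + (d1 + s * d2) ^+ 2 + (d1 - s * d2) ^+ 2 = 6 * r.
  rewrite /r; transitivity (6 * d1 ^+ 2 + 2 * s ^+ 2 * d2 ^+ 2); first by ring.
  by rewrite sE; ring.
(* Here a^2 + b^2 + c^2 = 2 a^2 - 2 b c <= 2 r^2 <= 4 r < 6 r. Up to signs, one of 2 d1, d1 + s d2,
   d1 - s d2 is always the sum of the other two taken with equal signs. *)
have bound a b c : a = b + c -> `|a| <= r -> `|b| <= r -> `|c| <= r ->
    0 <= b * c -> a ^+ 2 + b ^+ 2 + c ^+ 2 = 6 * r -> False.
  rewrite !ler_norml => -> /andP[? ?] /andP[? ?] /andP[? ?] ? ?; nra.
case: (lerP `|2 * d1| r) => [h1|]; last first.
  by rewrite lter_normr => /orP[] ?; [apply: Or42|apply: Or41]; lra.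
case: (lerP `|d1 + s * d2| r) => [h2|]; last first.
  by rewrite lter_normr => /orP[] ?; [apply: Or44; apply: Or31|apply: Or43]; lra.
case: (lerP `|d1 - s * d2| r) => [h3|]; last first.
  by rewrite lter_normr => /orP[] ?; apply: Or44; [apply: Or33|apply: Or32]; lra.
exfalso.
case: (lerP 0 ((d1 + s * d2) * (d1 - s * d2))) => h4.
  by apply: (bound (2 * d1) (d1 + s * d2) (d1 - s * d2)) => //; ring.
case: (lerP 0 ((2 * d1) * (- (d1 - s * d2)))) => h5.
  apply: (bound (d1 + s * d2) (2 * d1) (- (d1 - s * d2)));
    rewrite ?normrN ?sqrrN //; first by ring.
  by rewrite -E; ring.
apply: (bound (d1 - s * d2) (2 * d1) (- (d1 + s * d2)));
    rewrite ?normrN ?sqrrN //; first by ring.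
  rewrite leNgt; apply/negP => h6; move: h4 h5 h6.
  move: (2 * d1) (d1 + s * d2) (d1 - s * d2) => X Y Z h4 h5 h6.
  have : 0 < X * Z * (Y * X) by rewrite mulr_gt0 //; lra.
  have : X ^+ 2 * (Y * Z) <= 0 by rewrite mulr_ge0_le0 ?sqr_ge0 // ltW.
  lra.
by rewrite -E; ring.
Qed.

(** For vectors d, a, b one has |d + a|^2 + |d + b|^2 = |d|^2 + |d + a + b|^2 - 2 a.b, and here 2
    a.b = 3 - 1 - 1 = 1. *)
Lemma lens d1 d2 a1 a2 b1 b2 :
  a1 ^+ 2 + a2 ^+ 2 = 1 -> b1 ^+ 2 + b2 ^+ 2 = 1 ->
  (a1 + b1) ^+ 2 + (a2 + b2) ^+ 2 = 3 ->
  d1 ^+ 2 + d2 ^+ 2 < 1 -> (d1 + (a1 + b1)) ^+ 2 + (d2 + (a2 + b2)) ^+ 2 < 1 ->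
  (d1 + a1) ^+ 2 + (d2 + a2) ^+ 2 < 1.
Proof.
move=> a_unit b_unit sum3 Da Db.
have := addr_ge0 (sqr_ge0 (d1 + b1)) (sqr_ge0 (d2 + b2)); lra.
Qed.

End CyganGeometry.

(** * Eisenstein integers *)

Section Cusps.
Variable R : realType.
Local Notation C := R[i].
Local Notation o := (omegab R).
Local Notation Re := (@complex.Re R).
Local Notation Im := (@complex.Im R).
Implicit Types x y z b u e w g v f c : C.
Implicit Type A : 'M[C]_3.

Lemma ReD x y : Re (x + y) = Re x + Re y. Proof. by case: x; case: y. Qed.
Lemma ImD x y : Im (x + y) = Im x + Im y. Proof. by case: x; case: y. Qed.
Lemma ReN x : Re (- x) = - Re x. Proof. by case: x. Qed.
Lemma ImN x : Im (- x) = - Im x. Proof. by case: x. Qed.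
Lemma ReM x y : Re (x * y) = Re x * Re y - Im x * Im y.
Proof. by case: x; case: y. Qed.
Lemma ImM x y : Im (x * y) = Re x * Im y + Im x * Re y.
Proof. by case: x; case: y. Qed.
Lemma ReJ x : Re x^* = Re x. Proof. by case: x. Qed.
Lemma ImJ x : Im x^* = - Im x. Proof. by case: x. Qed.
Lemma Re1 : Re 1 = 1. Proof. by []. Qed.
Lemma Im1 : Im 1 = 0. Proof. by []. Qed.
Lemma Re_int (i : int) : Re i%:~R = i%:~R.
Proof. by rewrite -(rmorph_int (real_complex R)). Qed.
Lemma Im_int (i : int) : Im i%:~R = 0.
Proof. by rewrite -(rmorph_int (real_complex R)). Qed.
Let s : R := Num.sqrt 3.
Lemma Re_o : Re o = - 2^-1. Proof. by []. Qed.
Lemma Im_o : Im o = - (s / 2). Proof. by []. Qed.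
Let s_sqr : s ^+ 2 = 3. Proof. by rewrite sqr_sqrtr // ler0n. Qed.
Definition ReImE := (ReD, ImD, ReN, ImN, ReM, ImM, ReJ, ImJ, Re1, Im1,
  Re_int, Im_int, Re_o, Im_o).

Definition sqn z : R := Re z ^+ 2 + Im z ^+ 2.

Lemma sqn_ge0 z : 0 <= sqn z. Proof. by rewrite addr_ge0 ?sqr_ge0. Qed.
Lemma sqnM x y : sqn (x * y) = sqn x * sqn y.
Proof. by rewrite /sqn !ReImE; ring. Qed.
Lemma sqn_eq0 z : (sqn z == 0) = (z == 0).
Proof. by rewrite /sqn paddr_eq0 ?sqr_ge0 // !sqrf_eq0 eq_complex. Qed.

Lemma complexP x y : Re x = Re y -> Im x = Im y -> x = y.
Proof. by case: x => ? ?; case: y => ? ? /= -> ->. Qed.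

Lemma mulJ_eq1 z : z * z^* = 1 <-> sqn z = 1.
Proof.
split=> [/(congr1 Re)|h]; first by rewrite !ReImE /sqn => h; lra.
by apply: complexP; rewrite !ReImE; move: h; rewrite /sqn => h; lra.
Qed.

Definition eis z := exists i j : int, z = i%:~R + j%:~R * o.

Lemma eis_int (i : int) : eis i%:~R.
Proof. by exists i, 0; rewrite mul0r addr0. Qed.
Lemma eis0 : eis 0. Proof. exact: (eis_int 0). Qed.
Lemma eis1 : eis 1. Proof. exact: (eis_int 1). Qed.
Lemma eis_o : eis o. Proof. by exists 0, 1; rewrite mul1r add0r. Qed.
Lemma eisD x y : eis x -> eis y -> eis (x + y).
Proof.
move=> [i [j ->]] [k [l ->]]; exists (i + k), (j + l); rewrite !rmorphD; ring.
Qed.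
Lemma eisN x : eis x -> eis (- x).
Proof. by move=> [i [j ->]]; exists (- i), (- j); rewrite !rmorphN; ring. Qed.
Lemma eisM x y : eis x -> eis y -> eis (x * y).
Proof.
move=> [i [j ->]] [k [l ->]]; exists (i * k - j * l), (i * l + j * k - j * l).
rewrite !(rmorphD, rmorphN, rmorphM) /=; ring: (omegab_sqr R).
Qed.
Lemma eisJ x : eis x -> eis x^*.
Proof.
move=> [i [j ->]]; exists (i - j), (- j).
by apply: complexP; rewrite !ReImE !(rmorphD, rmorphN) /=; lra.
Qed.

Lemma sqn_eis (i j : int) :
  sqn (i%:~R + j%:~R * o) = (i ^+ 2 - i * j + j ^+ 2)%:~R.
Proof.
rewrite /sqn !ReImE !(rmorphD, rmorphN, rmorphM, rmorphXn) /=.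
by field: s_sqr.
Qed.

(** Norms of Eisenstein integers are integers, so the height of a path can be lowered one unit at a
    time. *)
Lemma eis_ltS z (n : nat) :
  eis z -> sqn z < n.+1%:R -> sqn z = n%:R \/ sqn z < n%:R.
Proof.
move=> [i [j ->]]; rewrite sqn_eis -[n.+1%:R]/(n.+1%:Z%:~R) -[n%:R]/(n%:Z%:~R).
rewrite !ltr_int intS (addrC 1 n%:Z) ltzD1 le_eqVlt.
by case/orP => [/eqP ->|]; [left|right].
Qed.

(* (x, b, 1) is then an isotropic vector. *)
Definition heis_point b x := [/\ eis b, eis x & x + x^* = - (b * b^*)].
Definition eis_unit u := eis u /\ sqn u = 1.
(** Only the primitive roots: e + e^* = - 1 makes (u, e) a Heisenberg point for every unit u. *)
Definition cube_root e := e = o \/ e = - 1 - o.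

Lemma eis_cube_root e : cube_root e -> eis e.
Proof.
case=> ->; first exact: eis_o.
by apply: eisD (eisN eis_o); apply: eisN eis1.
Qed.
Lemma cube_rootJ e : cube_root e -> cube_root e^*.
Proof.
case=> ->; [right; exact: omegab_conj|left].
by rewrite rmorphB rmorphN rmorph1 /= omegab_conj; ring.
Qed.
Lemma cube_root_sum e : cube_root e -> e^* = - 1 - e.
Proof.
case=> ->; first exact: omegab_conj.
by rewrite rmorphB rmorphN rmorph1 /= omegab_conj; ring.
Qed.
Lemma cube_root_sqr e : cube_root e -> e ^+ 2 = - 1 - e.
Proof.
case=> ->; first exact: omegab_sqr.
by ring: (omegab_sqr R).
Qed.
Lemma cube_root_norm e : cube_root e -> e * e^* = 1.
Proof. by move=> he; rewrite cube_root_sum //; ring: (cube_root_sqr he). Qed.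

(** The new point is T(b, x) T(u, e); as |e| = 1, this is a step of Cygan length 1. *)
Lemma heis_point_step b x u e : heis_point b x -> eis_unit u -> cube_root e ->
  heis_point (b + u) (x + e - b^* * u).
Proof.
move=> [hb hx bx] [hu /mulJ_eq1 u1] he; split; first exact: eisD.
  by apply: eisD (eisD _ (eis_cube_root he)) (eisN (eisM (eisJ hb) hu)).
rewrite !rmorphD rmorphN rmorphM /= conjCK (cube_root_sum he).
have -> : x + e - b^* * u + (x^* + (- 1 - e) - b * u^*) =
  (x + x^*) - 1 - b^* * u - b * u^* by ring.
by rewrite bx -u1; ring.
Qed.

(** The form i^2 - i j + j^2 omits the value 2, and its vectors of value 3 are sums of two units. *)
Lemma eis_lt4 z : eis z -> sqn z < 4 ->
  [\/ z = 0, eis_unit z |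
      exists u1 u2, [/\ eis_unit u1, eis_unit u2, z = u1 + u2 & sqn z = 3]].
Proof.
move=> [i [j zE]]; have zN := sqn_eis i j; rewrite -zE in zN.
have ez : eis z by exists i, j.
set m := i ^+ 2 - i * j + j ^+ 2 in zN.
move=> z4; have m4 : m < 4 by rewrite -(ltr_int R) -zN.
have m0 : 0 <= m by rewrite -(ler_int R) -zN sqn_ge0.
have m1 : m = 0 \/ m = 1 \/ m = 2 \/ m = 3 by lia.
have unitI (p q : int) : p ^+ 2 - p * q + q ^+ 2 = 1 ->
    eis_unit (p%:~R + q%:~R * o).
  by move=> h; split; [exists p, q|rewrite sqn_eis h].
have split3 (p q p' q' : int) : p ^+ 2 - p * q + q ^+ 2 = 1 ->
    p' ^+ 2 - p' * q' + q' ^+ 2 = 1 -> i = p + p' -> j = q + q' -> m = 3 ->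
    exists u1 u2, [/\ eis_unit u1, eis_unit u2, z = u1 + u2 & sqn z = 3].
  move=> h h' iE jE m3; exists (p%:~R + q%:~R * o), (p'%:~R + q'%:~R * o).
  split; [exact: unitI|exact: unitI| |by rewrite zN m3].
  by rewrite zE iE jE !rmorphD /=; ring.
(* Completing the square bounds |i| and |j| by 2, which leaves 25 pairs to inspect. *)
have sq4 : (2 * i - j) ^+ 2 + 3 * j ^+ 2 = 4 * m by rewrite /m; ring.
have ib : -2 <= i <= 2 by nia.
have jb : -2 <= j <= 2 by nia.
have {}ib : i = 0 \/ i = 1 \/ i = -1 \/ i = 2 \/ i = -2 by lia.
have {}jb : j = 0 \/ j = 1 \/ j = -1 \/ j = 2 \/ j = -2 by lia.
case: m1 => [mE|[mE|[mE|mE]]].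
- by apply: Or31; apply/eqP; rewrite -sqn_eq0 zN mE.
- by apply: Or32; split; rewrite // zN mE.
- by exfalso; move: sq4; rewrite mE; case: ib => [->|[->|[->|[->|->]]]];
    case: jb => [->|[->|[->|[->|->]]]].
apply: Or33.
have : [\/ i = 1 /\ j = 2, i = -1 /\ j = -2, i = 2 /\ j = 1 |
    [\/ i = -2 /\ j = -1, i = 1 /\ j = -1 | i = -1 /\ j = 1]].
  move: sq4; rewrite mE; case: ib => [->|[->|[->|[->|->]]]];
    case: jb => [->|[->|[->|[->|->]]]] //= _;
  do [by apply: Or41|by apply: Or42|by apply: Or43|by apply: Or44; apply: Or31
     |by apply: Or44; apply: Or32|by apply: Or44; apply: Or33].
case=> [[iE jE]|[iE jE]|[iE jE]|[[iE jE]|[iE jE]|[iE jE]]].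
- by apply: (split3 0 1 1 1).
- by apply: (split3 0 (-1) (-1) (-1)).
- by apply: (split3 1 0 1 1).
- by apply: (split3 (-1) 0 (-1) (-1)).
- by apply: (split3 1 0 0 (-1)).
- by apply: (split3 (-1) 0 0 1).
Qed.

(** * The neighbours of a cusp *)

Section Link.
Variables w g : C.
Hypothesis wg : g + g^* = - (w * w^*).
(* Seen from a cusp, the base cusp is the point of the Heisenberg group with
   plane coordinate w^*; the squared Cygan distance from it to (b, x) is
   |link_value b x|, and D b is the planar part of the displacement. *)
Let D b := b - w^*.
Definition link_value b x := x + w * b + g.
Local Notation v := link_value.

(** v + v^* = - b b^* - w w^* + w b + (w b)^* = - |b - w^*|^2. *)
Lemma link_value_Re b x : heis_point b x -> 2 * Re (v b x) = - sqn (D b).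
Proof.
case=> _ _ /(congr1 Re); move: wg => /(congr1 Re).
rewrite /v /D /sqn !ReImE => h1 h2; lra.
Qed.

Lemma link_value_step b x u e :
  v (b + u) (x + e - b^* * u) = v b x + e - (D b)^* * u.
Proof. by rewrite /v /D rmorphB /= conjCK; ring. Qed.

Lemma edge_step b x u : heis_point b x -> sqn (v b x) <= 1 -> eis_unit u ->
  sqn (D b + u) < 1 ->
  exists2 e, cube_root e & sqn (v (b + u) (x + e - b^* * u)) < 1.
Proof.
move=> hT hv [_ hu] hD.
(* With h = s / 2, the number k given by [edge_exists] is the imaginary part of a primitive cube
   root of unity. *)
have h34 : 4 * (s / 2) ^+ 2 = 3 by field: s_sqr.
move: hD hu hv (link_value_Re hT); rewrite /sqn !(ReD (D b)) !(ImD (D b)).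
move=> hD hu hv hR; have [k hk hs] := edge_exists hR hv hu hD h34.
have [e he [eR eI]] : exists2 e, cube_root e & Re e = - 2^-1 /\ Im e = k.
  case: hk => ->; [exists (- 1 - o)|exists o]; rewrite /cube_root ?ReImE; auto;
    split=> //; lra.
exists e => //; rewrite link_value_step /sqn !ReImE eR eI.
move: hs; rewrite /v /D !ReImE => hs.
by apply: le_lt_trans hs; rewrite le_eqVlt; apply/orP; left; apply/eqP; ring.
Qed.

Lemma unit_exists b x : heis_point b x -> sqn (v b x) <= 1 -> D b != 0 ->
  exists2 u, eis_unit u & sqn (D b + u) < 1.
Proof.
move=> hT hv; rewrite -sqn_eq0 => h0; have hR := link_value_Re hT.
(* 4 (Re v)^2 = |D b|^4, and |v| <= 1. *)
have r2 : sqn (D b) <= 2.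
  by move: hv hR; rewrite /(sqn (v b x)) => hv hR;
    have := sqr_ge0 (Im (v b x)); nra.
have wit u p q : eis u -> Re u = p -> Im u = q -> p ^+ 2 + q ^+ 2 = 1 ->
    sqn (D b) + 2 * (Re (D b) * p + Im (D b) * q) < 0 ->
    exists2 u, eis_unit u & sqn (D b + u) < 1.
  move=> hu <- <- u1 h; exists u; first by [].
  by move: u1 h; rewrite /sqn !(ReD (D b)) !(ImD (D b)) => u1 h; lra.
have eo2 : eis (- 1 - o) by apply: eis_cube_root; right.
have half : (2^-1 : R) ^+ 2 + (s / 2) ^+ 2 = 1 by field: s_sqr.
have [h|h|h|[h|h|h]] := unit_step s_sqr h0 r2; rewrite -/(sqn (D b)) in h.
- by apply: (wit 1 1 0 eis1) => //; [ring|lra].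
- apply: (wit (- 1) (- 1) 0 (eisN eis1));
    [by rewrite !ReImE|by rewrite !ReImE oppr0|ring|lra].
- apply: (wit (- o) (2^-1) (s / 2) (eisN eis_o));
    [by rewrite !ReImE opprK|by rewrite !ReImE opprK|by []|lra].
- by apply: (wit o (- 2^-1) (- (s / 2)) eis_o); rewrite ?sqrrN //; lra.
- apply: (wit (- (- 1 - o)) (2^-1) (- (s / 2)) (eisN eo2));
    [by rewrite !ReImE; lra|by rewrite !ReImE; lra|by rewrite sqrrN|lra].
- apply: (wit (- 1 - o) (- 2^-1) (s / 2) eo2);
    [by rewrite !ReImE; lra|by rewrite !ReImE; lra|by rewrite sqrrN|lra].
Qed.

(** 2 e + 1 is i sqrt 3 or its opposite, the spacing of a column; the point found is one step away
    from both (b, x) and (b, x + 2 e + 1). *)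
Lemma middle_step b x e : heis_point b x -> cube_root e -> sqn (v b x) <= 1 ->
  sqn (v b (x + 2 * e + 1)) <= 1 ->
  exists2 u, eis_unit u & sqn (v (b + u) (x + e - b^* * u)) < 1.
Proof.
move=> hT he hv hv'; have hR := link_value_Re hT.
have [eR eI] : Re e = - 2^-1 /\ 4 * Im e ^+ 2 = 3.
  by case: he => ->; rewrite ?ReImE; split; try lra; field: s_sqr.
have vE : v b (x + 2 * e + 1) = v b x + (2 * e + 1) by rewrite /v; ring.
have [D0|D0] := eqVneq (D b) 0.
  (* When D b = 0 the new value is v + e for every unit u, so u = 1 serves. *)
  exists 1; first by split; [exact: eis1|rewrite /sqn !ReImE; ring].
  move: hR; rewrite link_value_step D0 (_ : sqn 0 = 0) ?oppr0 => [hR|];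
    last by rewrite /sqn /=; ring.
  have {}hR : Re (v b x) = 0 by lra.
  move: hv hv'; rewrite vE rmorph0 mul0r subr0.
  rewrite /sqn !(ReD (v b x)) !(ImD (v b x)) hR.
  rewrite !(ReD (2 * e)) !(ImD (2 * e)) (ReM 2) (ImM 2) eR.
  rewrite -[Re 2]/(Re (2%:Z%:~R)) -[Im 2]/(Im (2%:Z%:~R)) Re_int Im_int Re1 Im1 /=.
  move: (Im (v b x)) (Im e) eI => p q; nra.
have [u hu hD] := unit_exists hT hv D0; exists u => //.
case: hu => _ hu; move: hv hv' hR hu hD; rewrite vE link_value_step.
rewrite /sqn !(ReD (D b)) !(ImD (D b)).
rewrite !(ReD (v b x)) !(ImD (v b x)).
rewrite !(ReD (2 * e)) !(ImD (2 * e)) (ReM 2) (ImM 2) eR.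
rewrite -[Re 2]/(Re (2%:Z%:~R)) -[Im 2]/(Im (2%:Z%:~R)) Re_int Im_int Re1 Im1 /=.
move=> hv hv' hR hu hD.
have {}hv' : Re (v b x) ^+ 2 + (Im (v b x) + 2 * Im e) ^+ 2 <= 1 by lra.
have := middle_strict hR hv hv' hu hD eI.
rewrite -(opprK 2^-1) -eR /v /D !ReImE => hs.
by apply: le_lt_trans hs; rewrite le_eqVlt; apply/orP; left; apply/eqP; ring.
Qed.

(** * Connectedness of the open Cygan ball *)

Variable P : C -> C -> Prop.
(** In the application [P b x] says that the neighbour (b, x) is reached, with the right translation
    sum, by a word of height less than n. *)
Hypothesis P_step : forall b x u e,
  heis_point b x -> eis_unit u -> cube_root e -> P b x ->
  sqn (v (b + u) (x + e - b^* * u)) < 1 -> P (b + u) (x + e - b^* * u).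

Lemma eis_unitN u : eis_unit u -> eis_unit (- u).
Proof. by case=> hu u1; split; [exact: eisN|rewrite -u1 /sqn !ReImE !sqrrN]. Qed.

Lemma step_back b x u e : heis_point b x -> eis_unit u -> cube_root e ->
  P (b + u) (x + e - b^* * u) -> sqn (v b x) < 1 -> P b x.
Proof.
move=> hT hu he hPu hv; have hT' := heis_point_step hT hu he.
have /mulJ_eq1 u1 : sqn u = 1 by case: hu.
have bE : b + u - u = b by ring.
have xE : x + e - b^* * u + e^* - (b + u)^* * - u = x.
  by rewrite rmorphD /= (cube_root_sum he); ring: u1.
by have := P_step hT' (eis_unitN hu) (cube_rootJ he) hPu; rewrite bE xE; apply.
Qed.

(** One step at most brings a point to planar distance less than 1 from the centre. The equivalence
    lets this serve at both ends of a path. *)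
Lemma near_column b x : heis_point b x -> sqn (v b x) < 1 ->
  exists b' x', [/\ heis_point b' x', sqn (v b' x') < 1, sqn (D b') < 1
    & P b x <-> P b' x'].
Proof.
move=> hT hv; have [hD|hD] := ltrP (sqn (D b)) 1; first by exists b, x; split.
have D0 : D b != 0 by rewrite -sqn_eq0; apply: contraTneq hD => ->; rewrite -ltNge.
have [u hu Du] := unit_exists hT (ltW hv) D0.
have [e he hv'] := edge_step hT (ltW hv) hu Du.
exists (b + u), (x + e - b^* * u); split => //; first exact: heis_point_step.
  by rewrite /D addrAC.
by split=> [hP|hP]; [exact: P_step|exact: step_back hP hv].
Qed.

Lemma edge_column b x u :
  heis_point b x -> sqn (v b x) < 1 -> P b x -> eis_unit u ->
  sqn (D (b + u)) < 1 ->
  exists x', [/\ heis_point (b + u) x', sqn (v (b + u) x') < 1 & P (b + u) x'].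
Proof.
move=> hT hv hP hu; rewrite {1}/D addrAC -/(D b) => Du.
have [e he hv'] := edge_step hT (ltW hv) hu Du.
by exists (x + e - b^* * u); split => //; [exact: heis_point_step|exact: P_step].
Qed.

(** By the parallelogram law b' - b has norm less than 4, so it is 0, a unit or a sum of two units;
    in the last case [lens] keeps the intermediate column within planar distance 1. *)
Lemma change_column b x b' : heis_point b x -> sqn (v b x) < 1 -> P b x ->
  sqn (D b) < 1 -> eis b' -> sqn (D b') < 1 ->
  exists x', [/\ heis_point b' x', sqn (v b' x') < 1 & P b' x'].
Proof.
move=> hT hv hP hD hb' hD'.
have hk : eis (b' - b) by apply: eisD hb' (eisN _); case: hT.
have k4 : sqn (b' - b) < 4.
  move: hD hD'; rewrite /sqn /D !ReImE.
  have := sqr_ge0 (Re b + Re b' - 2 * Re w).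
  have := sqr_ge0 (Im b + Im b' + 2 * Im w); lra.
have bE : b + (b' - b) = b' by ring.
have [k0|k1|[u1 [u2 [hu1 hu2 kE k3]]]] := eis_lt4 hk k4.
- by exists x; move: bE; rewrite k0 addr0 => <-.
- by have := edge_column hT hv hP k1; rewrite bE => /(_ hD').
have D1 : sqn (D (b + u1)) < 1.
  have -> : D (b + u1) = D b + u1 by rewrite /D addrAC.
  have D2 : D b' = D b + (u1 + u2) by rewrite -kE /D; ring.
  move: k3 hD hD'; case: hu1 hu2 => _ + [_]; rewrite D2 kE.
  rewrite /sqn !(ReD (D b)) !(ImD (D b)) !(ReD u1) !(ImD u1) => h1 h2 h3 h4 h5.
  exact: lens h1 h2 h3 h4 h5.
have [x1 [hT1 hv1 hP1]] := edge_column hT hv hP hu1 D1.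
have bE2 : b + u1 + u2 = b' by rewrite -addrA -kE.
by have := edge_column hT1 hv1 hP1 hu2; rewrite bE2 => /(_ hD').
Qed.

(** x' - x is a multiple i (1 + 2 o), and 3 i^2 < 4 leaves i = 0, 1, - 1; if i is not 0,
    [middle_step] gives a detour of two steps. *)
Lemma same_column b x x' : heis_point b x -> heis_point b x' -> sqn (v b x) < 1 ->
  sqn (v b x') < 1 -> P b x -> P b x'.
Proof.
move=> hT hT' hv hv' hP.
have rise e : cube_root e -> x' = x + 2 * e + 1 -> P b x'.
  move=> he xE; have [] := middle_step hT he (ltW hv); first by rewrite -xE ltW.
  move=> u hu hs.
  apply: (step_back hT' hu (cube_rootJ he) _ hv').
  have -> : x' + e^* - b^* * u = x + e - b^* * u.
    by rewrite xE cube_root_sum //; ring.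
  exact: P_step.
have : eis (x' - x) by apply: eisD (eisN _); [case: hT'|case: hT].
case=> i [j tE].
have jE : j = 2 * i.
  case: hT hT' => _ _ h1 [_ _ h2].
  have : Re (x' - x) = 0.
    by move: h1 h2 => /(congr1 Re) + /(congr1 Re); rewrite !ReImE; lra.
  rewrite tE !ReImE mul0r subr0 => h.
  apply/eqP; rewrite -(eqr_int R) rmorphM /=; apply/eqP; lra.
have tE' : x' - x = i%:~R * (1 + 2 * o) by rewrite tE jE rmorphM /=; ring.
have i2 : i ^+ 2 < 2.
  have vv : v b x' - v b x = i%:~R * (1 + 2 * o) by rewrite -tE' /v; ring.
  have : sqn (v b x' - v b x) < 4.
    move: hv hv'; rewrite /sqn !(ReD (v b x')) !(ImD (v b x')) ReN ImN.
    have := sqr_ge0 (Re (v b x) + Re (v b x')).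
    have := sqr_ge0 (Im (v b x) + Im (v b x')); lra.
  rewrite vv sqnM (_ : sqn (1 + 2 * o) = 3); last first.
    rewrite /sqn !ReImE.
    by field: s_sqr.
  rewrite /sqn Re_int Im_int -(ltr_int R) rmorphXn /=; lra.
have [i0|[i1|i1]] : i = 0 \/ i = 1 \/ i = -1 by nia.
- by move/eqP: tE'; rewrite i0 mul0r subr_eq0 => /eqP ->.
- apply: (rise o); first by left.
  by apply: (addIr (- x)); rewrite tE' i1; ring.
- apply: (rise (- 1 - o)); first by right.
  by apply: (addIr (- x)); rewrite tE' i1; ring.
Qed.

Lemma link_connected b x b' x' :
  heis_point b x -> heis_point b' x' -> sqn (v b x) < 1 ->
  sqn (v b' x') < 1 -> P b x -> P b' x'.
Proof.
move=> hT hT' hv hv' hP.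
have [b1 [x1 [hT1 hv1 hD1 hP1]]] := near_column hT hv.
have [b2 [x2 [hT2 hv2 hD2 hP2]]] := near_column hT' hv'.
have hb2 : eis b2 by case: hT2.
have [x3 [hT3 hv3 hP3]] := change_column hT1 hv1 (hP1.1 hP) hD1 hb2 hD2.
apply/hP2; exact: same_column hT3 hT2 hv3 hv2 hP3.
Qed.

(** Off the axis D b = 0 this follows from [edge_step]. On it v is i or - i, and the root e with
    imaginary part of the opposite sign gives 1/4 + (1 - sqrt 3 / 2)^2 < 1. *)
Lemma strict_neighbour b x : heis_point b x -> sqn (v b x) = 1 ->
  exists u e, [/\ eis_unit u, cube_root e & sqn (v (b + u) (x + e - b^* * u)) < 1].
Proof.
move=> hT hv; have [D0|D0] := eqVneq (D b) 0; last first.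
  have hv' : sqn (v b x) <= 1 by rewrite hv.
  have [u hu hD] := unit_exists hT hv' D0.
  by have [e he he'] := edge_step hT hv' hu hD; exists u, e.
have hR := link_value_Re hT; move: hR hv.
rewrite D0 /sqn [Re 0]/= [Im 0]/= => hR.
have {}hR : Re (v b x) = 0 by move: hR; rewrite expr0n /=; lra.
rewrite hR => hI.
have s0 : 0 <= s by rewrite sqrtr_ge0.
have s1 : 1 <= s by have := s_sqr; nra.
have hu : eis_unit 1 by split; [exact: eis1|rewrite /sqn !ReImE; ring].
have witness e : cube_root e -> (Im (v b x) + Im e) ^+ 2 < 3 / 4 ->
    exists u e, [/\ eis_unit u, cube_root e &
      Re (v (b + u) (x + e - b^* * u)) ^+ 2 +
      Im (v (b + u) (x + e - b^* * u)) ^+ 2 < 1].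
  move=> he h; exists 1, e; split=> //.
  have eR : Re e = - 2^-1 by case: he => ->; rewrite ?ReImE; lra.
  rewrite link_value_step D0 rmorph0 mul0r subr0.
  rewrite (ReD (v b x)) (ImD (v b x)) hR eR; lra.
have [hv|hv] : Im (v b x) = 1 \/ Im (v b x) = -1.
  have : Im (v b x) ^+ 2 == 1 by apply/eqP; lra.
  by rewrite sqrf_eq1 => /orP[] /eqP ->; [left|right].
- by apply: (witness o); [left|rewrite hv Im_o; have := s_sqr; nra].
- by apply: (witness (- 1 - o)); [right|rewrite hv !ReImE; have := s_sqr; nra].
Qed.

End Link.

(** * Paths of cusps *)

Section Paths.

Definition heis b x : 'M[C]_3 :=
  mx3 [:: [:: 1; - b^*; x]; [:: 0; 1; b]; [:: 0; 0; 1]].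
Definition inversion : 'M[C]_3 :=
  mx3 [:: [:: 0; 0; 1]; [:: 0; - 1; 0]; [:: 1; 0; 0]].
Local Notation T := heis.
Local Notation J := inversion.

Ltac mx_ring := apply/matrixP; apply: forall3; apply: forall3;
  rewrite /heis /inversion !mxE ?sum3 ?mxE /=.

Lemma heisM b x b' x' : T b x *m T b' x' = T (b + b') (x + x' - b^* * b').
Proof.
have E : (b + b')^* = b^* + b'^* by rewrite rmorphD.
by mx_ring; rewrite ?E; ring.
Qed.

Lemma heis0 : T 0 0 = 1%:M.
Proof.
have E : (0 : C)^* = 0 by rewrite rmorph0.
by mx_ring; rewrite ?E; ring.
Qed.

Lemma inversionK : J *m J = 1%:M.
Proof. by mx_ring; ring. Qed.

Lemma inversion_heis b x :
  J *m T b x = mx3 [:: [:: 0; 0; 1]; [:: 0; - 1; - b]; [:: 1; - b^*; x]].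
Proof. by mx_ring; ring. Qed.

Lemma inversion_conj b x :
  J *m T b x *m J = mx3 [:: [:: 1; 0; 0]; [:: - b; 1; 0]; [:: x; b^*; 1]].
Proof. by rewrite inversion_heis; mx_ring; ring. Qed.

(** The left word visits the cusp J(infinity) between two adjacent cusps; the right one goes
    directly. The translation sums agree because u = - u e^* - u e. *)
Lemma triangle u e : eis_unit u -> cube_root e ->
  J *m T u e *m J = e *: (T (- (u * e^*)) e^* *m J *m T (- (u * e)) e^*).
Proof.
move=> [_ /mulJ_eq1 u1] he; rewrite inversion_conj -mulmxA inversion_heis.
have E1 : e^* = - 1 - e := cube_root_sum he.
have E2 : (- (u * e^*))^* = - (u^* * e) by rewrite rmorphN rmorphM /= conjCK.
have E3 : (- (u * e))^* = - (u^* * e^*) by rewrite rmorphN rmorphM.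
have E4 := cube_root_sqr he.
mx_ring; rewrite ?E2 ?E3 ?E1.
all: ring: E4 u1.
Qed.

(* [reach n A f]: some word with value A has translation sum f, and all its
   prefixes have height less than n (for n > 0). *)
Inductive reach (n : nat) : 'M[C]_3 -> C -> Prop :=
| reach_one : reach n 1%:M 0
| reach_heis A f b x : heis_point b x -> reach n A f -> reach n (A *m T b x) (f + b)
| reach_inversion A f :
    reach n A f -> sqn ((A *m J) 2 0) < n%:R -> reach n (A *m J) f
| reach_scale A f c : cube_root c -> reach n A f -> reach n (c *: A) f.

Lemma reach_mono m n A f : (m <= n)%N -> reach m A f -> reach n A f.
Proof.
move=> mn; elim=> {A f} [|A f b x hT _ hA|A f _ hA h|A f c hc _ hA].
- exact: reach_one.
- exact: reach_heis.
- by apply: reach_inversion => //; apply: lt_le_trans h _; rewrite ler_nat.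
- exact: reach_scale.
Qed.

Lemma heis_row A b x :
  [/\ (A *m T b x) 2 0 = A 2 0, (A *m T b x) 2 1 = A 2 1 - A 2 0 * b^*
    & (A *m T b x) 2 2 = A 2 0 * x + A 2 1 * b + A 2 2].
Proof. by rewrite !mxE !sum3 /heis !mxE /=; split; ring. Qed.

Lemma inversion_row A :
  [/\ (A *m J) 2 0 = A 2 2, (A *m J) 2 1 = - A 2 1 & (A *m J) 2 2 = A 2 0].
Proof. by rewrite !mxE !sum3 /inversion !mxE /=; split; ring. Qed.

(** Isotropy of the last row for the Hermitian form. *)
Definition null_row (A : 'M[C]_3) :=
  A 2 0 * (A 2 2)^* + A 2 1 * (A 2 1)^* + A 2 2 * (A 2 0)^* = 0.

Lemma reach_null n A f : reach n A f -> null_row A.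
Proof.
rewrite /null_row; elim=> {A f} [|A f b x [_ _ bx] _ hA|A f _ hA _|A f c hc _ hA].
- by rewrite !mxE /= rmorph0; ring.
- have [-> -> ->] := heis_row A b x.
  rewrite !(rmorphD, rmorphN, rmorphM) /= conjCK.
  move: hA; set p := (A 2 0)^*; set q := (A 2 1)^*; set r := (A 2 2)^* => hA.
  have xE : x^* = - x - b * b^* by rewrite -bx; ring.
  by rewrite xE -[RHS]hA; ring.
- have [-> -> ->] := inversion_row A; rewrite -hA rmorphN; ring.
- rewrite !mxE !rmorphM /= -[RHS](mulr0 (c * c^*)) -hA; ring.
Qed.

Lemma reach_eis n A f : reach n A f -> forall i j, eis (A i j).
Proof.
elim=> {A f} [|A f b x [hb hx _] _ hA|A f _ hA _|A f c hc _ hA] i j.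
- by rewrite mxE; case: (i == j); [exact: eis1|exact: eis0].
- rewrite mxE sum3; apply: eisD; [apply: eisD|];
    (apply: eisM; first exact: hA); move: j; apply: forall3;
    rewrite /heis mxE /=;
    first [exact: eis0|exact: eis1|exact: hb|exact: hx|exact/eisN/eisJ].
- rewrite mxE sum3; apply: eisD; [apply: eisD|];
    (apply: eisM; first exact: hA); move: j; apply: forall3;
    rewrite /inversion mxE /=;
    first [exact: eis0|exact: eis1|exact: (eisN eis1)].
- by rewrite mxE; apply: eisM (eis_cube_root hc) (hA i j).
Qed.

(** A first [J] after c T(f, x) would create the corner entry c of norm 1, so no [J] occurs, and the
    b's of translations add up. *)
Lemma reach_flat A f : reach 1 A f -> exists c x, sqn c = 1 /\ A = c *: T f x.
Proof.
have sqn1 : sqn (1 : C) = 1 by rewrite /sqn /= expr1n expr0n addr0.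
have T20 b x : T b x 2 0 = 0 by rewrite /heis !mxE.
have T22 b x : T b x 2 2 = 1 by rewrite /heis !mxE.
elim=> {A f} [|A f b x hT _ [c [x' [hc ->]]]|A f _ [c [x' [hc ->]]]
             |A f c hc _ [c' [x' [hc' ->]]]].
- by exists 1, 0; rewrite scale1r heis0.
- by exists c, (x' + x - f^* * b); rewrite -scalemxAl heisM.
- by have [-> _ _] := inversion_row (c *: T f x'); rewrite mxE T22 mulr1 hc ltxx.
exists (c * c'), x'; split; last by rewrite scalerA.
by rewrite sqnM hc' mulr1; apply/mulJ_eq1/cube_root_norm.
Qed.

Lemma eis_unitM u u' : eis_unit u -> eis_unit u' -> eis_unit (u * u').
Proof.
by move=> [hu u1] [hu' u1']; split; [exact: eisM|rewrite sqnM u1 u1' mulr1].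
Qed.

Lemma eis_unit_cube_root e : cube_root e -> eis_unit e.
Proof.
by move=> he; split; [exact: eis_cube_root|exact/mulJ_eq1/cube_root_norm].
Qed.

Lemma heis_point_unit u e : eis_unit u -> cube_root e -> heis_point u e.
Proof.
move=> [hu /mulJ_eq1 u1] he; split=> //; first exact: eis_cube_root.
by rewrite u1 (cube_root_sum he); ring.
Qed.

Lemma eis_unit1 : eis_unit (1 : C).
Proof. by split; [exact: eis1|rewrite /sqn /= expr1n expr0n addr0]. Qed.

(** * Pushing a path across a cusp of height n *)

Section Link.
Variables (n : nat) (A : 'M[C]_3) (f : C).
Hypotheses (A_null : null_row A) (A_norm : sqn (A 2 0) = n%:R) (n_gt0 : (0 < n)%N).
(** The last row divided by its corner entry is (1, w, g), and a neighbour of A has height n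
    |link_value|^2. *)
Let w := A 2 1 / A 2 0.
Let g := A 2 2 / A 2 0.
Let link b x := reach n (A *m T b x *m J) (f + b).

Lemma corner_neq0 : A 2 0 != 0.
Proof. by rewrite -sqn_eq0 A_norm pnatr_eq0 -lt0n. Qed.

Lemma link_wg : g + g^* = - (w * w^*).
Proof.
have a0 := corner_neq0; have a0' : (A 2 0)^* != 0 by rewrite conjC_eq0.
rewrite /w /g !rmorphM !fmorphV /=; apply: (mulfI a0); apply: (mulfI a0').
move: A_null; rewrite /null_row => h.
have {}h : A 2 1 * (A 2 1)^* = - (A 2 0 * (A 2 2)^*) - A 2 2 * (A 2 0)^*.
  by apply/eqP; rewrite -subr_eq0 -[X in _ == X]h; apply/eqP; ring.
by field: h; rewrite a0 a0'.
Qed.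

Lemma link_corner b x : (A *m T b x *m J) 2 0 = A 2 0 * link_value w g b x.
Proof.
have [-> _ _] := inversion_row (A *m T b x); have [_ _ ->] := heis_row A b x.
by rewrite /link_value /w /g; field; exact: corner_neq0.
Qed.

Lemma link_lt b x :
  (sqn ((A *m T b x *m J) 2 0) < n%:R) = (sqn (link_value w g b x) < 1).
Proof.
by rewrite link_corner sqnM A_norm -{2}[n%:R]mulr1 ltr_pM2l ?ltr0n.
Qed.

(** Inserting J J = 1 exposes J T(u, e) J, and [triangle] then leads from the old neighbour directly
    to the new one instead of through A. *)
Lemma link_step b x u e : heis_point b x -> eis_unit u -> cube_root e -> link b x ->
  sqn (link_value w g (b + u) (x + e - b^* * u)) < 1 ->
  link (b + u) (x + e - b^* * u).
Proof.
move=> hT hu he hP; rewrite /link -link_lt -heisM => hlt.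
have E : A *m (T b x *m T u e) *m J =
    e *: ((A *m T b x *m J) *m T (- (u * e^*)) e^* *m J *m T (- (u * e)) e^*).
  transitivity (A *m T b x *m J *m (J *m T u e *m J)).
    by rewrite !mulmxA -(mulmxA _ J J) inversionK mulmx1.
  by rewrite triangle // -scalemxAr !mulmxA.
have he' := cube_rootJ he.
have tr c : cube_root c -> heis_point (- (u * c)) e^*.
  by move=> hc; apply: heis_point_unit => //;
    apply/eis_unitN/eis_unitM/eis_unit_cube_root.
have fE : f + (b + u) = f + b - u * e^* - u * e by rewrite (cube_root_sum he); ring.
rewrite fE E; apply: reach_scale => //; apply: reach_heis; first exact: tr.
apply: reach_inversion; first by apply: reach_heis; first exact: tr.
move: hlt; rewrite E mxE; set M := _ *m J *m _ *m J.
have [-> _ _] := heis_row M (- (u * e)) e^*.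
by rewrite sqnM (mulJ_eq1 e).1 ?mul1r //; exact: cube_root_norm.
Qed.

Lemma reach_link b x b' x' : heis_point b x -> heis_point b' x' ->
  sqn (link_value w g b x) < 1 -> sqn (link_value w g b' x') < 1 ->
  link b x -> link b' x'.
Proof.
exact: (link_connected link_wg (P := link) link_step).
Qed.

End Link.

(** * Lowering the height of a path *)

Lemma heis_point0 : heis_point (0 : C) 0.
Proof. by split; [exact: eis0|exact: eis0|rewrite rmorph0; ring]. Qed.

Lemma heis_point_quot b x b' x' : heis_point b x -> heis_point b' x' ->
  exists2 y, heis_point (b' - b) y & T b x *m T (b' - b) y = T b' x'.
Proof.
move=> [hb hx bx] [hb' hx' bx']; exists (x' - x + b^* * (b' - b)); last first.
  by rewrite heisM; congr (T _ _); ring.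
split; first by apply: eisD (eisN _).
  by apply: eisD (eisD _ (eisN _)) (eisM (eisJ _) (eisD _ (eisN _))).
rewrite !(rmorphD, rmorphN, rmorphM) /= conjCK.
have xE : x^* = - x - b * b^* by rewrite -bx; ring.
have xE' : x'^* = - x' - b' * b'^* by rewrite -bx'; ring.
by rewrite xE xE'; ring.
Qed.

Lemma reach_lt n A f : (0 < n)%N -> reach n A f -> sqn (A 2 0) < n%:R.
Proof.
move=> n_gt0; elim=> {A f} [|A f b x _ _ hA|A f _ _ //|A f c hc _ hA].
- by rewrite !mxE /= /sqn /= expr0n addr0 ltr0n.
- by have [-> _ _] := heis_row A b x.
- by rewrite mxE sqnM (mulJ_eq1 c).1 ?mul1r //; exact: cube_root_norm.
Qed.

(** Induction on the word. The second claim is the invariant at a cusp of top height n: the word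
    cannot yet be lowered there, but one lower neighbour is already reached below n. *)
Lemma reach_descend n A f : (0 < n)%N -> reach n.+1 A f ->
  (sqn (A 2 0) < n%:R -> reach n A f) /\
  (sqn (A 2 0) = n%:R -> exists b x, [/\ heis_point b x,
     sqn ((A *m T b x *m J) 2 0) < n%:R & reach n (A *m T b x *m J) (f + b)]).
Proof.
move=> n_gt0; elim=> {A f}
  [|A f b x hT _ [hlt heq]|A f hA [hlt heq] hJ|A f c hc _ [hlt heq]].
- split=> [_|]; first exact: reach_one.
  rewrite !mxE /= /sqn /= expr0n addr0 => /eqP; rewrite eq_sym pnatr_eq0.
  by rewrite -[_ == _]negbK -lt0n n_gt0.
- have [-> _ _] := heis_row A b x; split=> [/hlt|/heq [b' [x' [hT' hl hr]]]].
    exact: reach_heis.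
  have [y hy yE] := heis_point_quot hT hT'; exists (b' - b), y.
  have -> : f + b + (b' - b) = f + b' by ring.
  by rewrite -(mulmxA A) yE; split.
- have A_null := reach_null hA.
  have A_cases := eis_ltS (reach_eis hA 2 0) (reach_lt (ltn0Sn n) hA).
  have T00 (B : 'M[C]_3) : B *m T 0 0 = B by rewrite heis0 mulmx1.
  split=> [hlt'|heq'].
    case: A_cases => [A_eq|/hlt hA']; last exact: reach_inversion.
    have [b [x [hT hl hr]]] := heq A_eq.
    (* Leaving a top cusp: (0, 0), which is A J, and (b, x) are both lower neighbours of A, so
       [reach_link] applies. *)
    have := reach_link A_null A_eq n_gt0 hT heis_point0 _ _ hr.
    by rewrite -!(link_lt A_eq) // T00 addr0; apply.
  case: A_cases => [A_eq|A_lt]; last first.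
    (* Arriving at a top cusp from below: the neighbour (0, 0) of A J is A. *)
    exists 0, 0; rewrite T00 -mulmxA inversionK mulmx1 addr0.
    by split; [exact: heis_point0| |exact: hlt].
  have [b [x [hT hl hr]]] := heq A_eq.
  (* Two adjacent top cusps: [strict_neighbour] gives a lower cusp adjacent to both, and
     [reach_link] reaches it. *)
  have d1 : sqn (link_value (A 2 1 / A 2 0) (A 2 2 / A 2 0) 0 0) = 1.
    have n0 : n%:R != 0 :> R by rewrite pnatr_eq0 -lt0n.
    apply: (mulfI n0); rewrite mulr1 -[in LHS]A_eq -sqnM.
    by rewrite -(link_corner A_eq n_gt0) T00 heq'.
  have [u [e [hu he hs]]] :=
    strict_neighbour (link_wg A_null A_eq n_gt0) heis_point0 d1.
  have hT1 := heis_point_step heis_point0 hu he.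
  have := reach_link A_null A_eq n_gt0 hT hT1 _ hs hr.
  rewrite -(link_lt A_eq) // => /(_ hl).
  move: hs hT1; rewrite -(link_lt A_eq) // rmorph0 mul0r subr0 !add0r => hs hT1 hr1.
  have he' := cube_rootJ he; have eJ := cube_root_norm he.
  have hu' : eis_unit (- (u * e^*)) by apply/eis_unitN/eis_unitM/eis_unit_cube_root.
  have E : A *m J *m T (- (u * e^*)) e^* *m J =
      e^* *: (A *m T u e *m J *m T (u * e) e).
    transitivity (A *m (J *m T (- (u * e^*)) e^* *m J)); first by rewrite !mulmxA.
    rewrite (triangle hu' he') conjCK.
    have -> : - (- (u * e^*) * e) = u by ring: eJ.
    have -> : - (- (u * e^*) * e^*) = u * e.
      rewrite mulNr opprK -mulrA -expr2.
      by rewrite (cube_root_sqr he') (cube_root_sum he); ring.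
    by rewrite -scalemxAr !mulmxA.
  have hT2 : heis_point (- (u * e^*)) e^* by exact: heis_point_unit.
  have hT3 : heis_point (u * e) e.
    by apply: heis_point_unit => //; apply/eis_unitM/eis_unit_cube_root.
  exists (- (u * e^*)), e^*; rewrite E; split=> //.
    rewrite mxE; set M := _ *m J.
    have [-> _ _] := heis_row M (u * e) e.
    by rewrite sqnM (mulJ_eq1 e^*).1 ?mul1r //; apply: cube_root_norm.
  have -> : f + - (u * e^*) = f + u + u * e by rewrite (cube_root_sum he); ring.
  by apply: reach_scale => //; apply: reach_heis.
rewrite mxE sqnM (mulJ_eq1 c).1 ?mul1r; last exact: cube_root_norm.
split=> [/hlt|/heq [b [x [hT hl hr]]]]; first exact: reach_scale.
exists b, x; split=> //; rewrite -!scalemxAl; last exact: reach_scale.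
by rewrite mxE sqnM (mulJ_eq1 c).1 ?mul1r //; exact: cube_root_norm.
Qed.

(** A corner entry 0 lies below every positive height, so [reach_descend] brings the bound down to
    1. *)
Lemma reach_stabilizer n A f : reach n.+1 A f -> A 2 0 = 0 ->
  exists c x, sqn c = 1 /\ A = c *: T f x.
Proof.
elim: n => [|n IHn] hA A0; first exact: reach_flat.
by apply: IHn => //; apply: (reach_descend (ltn0Sn n) hA).1;
  rewrite A0 /sqn /= expr0n addr0 ltr0n.
Qed.

Lemma reach_scalar n c f : reach n c%:M f -> f = 0.
Proof.
move=> /(reach_mono (leqnSn n)) hc.
have [|d [x [d1 /matrixP E]]] := reach_stabilizer hc; first by rewrite !mxE.
have d0 : d != 0 by rewrite -sqn_eq0 d1 oner_neq0.
by apply: (mulfI d0); have := E 1 2; rewrite /heis !mxE /= mulr0.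
Qed.

(** * Words in the generators g_1 and g_3 *)

Lemma reach_inversion_ex n A f : reach n A f -> exists m, reach m (A *m J) f.
Proof.
move=> hA; pose k := Num.bound (sqn ((A *m J) 2 0)); exists (maxn n k).
apply: reach_inversion; first exact: reach_mono (leq_maxl _ _) hA.
by apply: lt_le_trans (archi_boundP (sqn_ge0 _)) _; rewrite ler_nat leq_maxr.
Qed.

Lemma reach_rho1 n A f (g : knot_gen) : reach n A f ->
  exists m, reach m (A *m rho1_mx R g) (f - 1) /\
    reach m (A *m rho1_mxV R g) (f + 1).
Proof.
have t1 : heis_point (- 1) o.
  by apply: heis_point_unit; [apply/eis_unitN/eis_unit1|left].
have t2 : heis_point 1 (- 1 - o) by apply: heis_point_unit; [apply/eis_unit1|right].
have c1 : (1 : C)^* = 1 by rewrite rmorph1.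
have cN1 : (- 1 : C)^* = - 1 by rewrite rmorphN rmorph1.
case: g => hA.
  have E1 : rho1_mx R G1 = T (- 1) o by rewrite /heis cN1 opprK.
  have E2 : rho1_mxV R G1 = T 1 (- 1 - o) by rewrite /heis c1.
  by exists n; rewrite E1 E2; split; apply: reach_heis.
have E1 : rho1_mx R G3 = J *m T (- 1) o *m J by rewrite inversion_conj cN1 opprK.
have E2 : rho1_mxV R G3 = J *m T 1 (- 1 - o) *m J by rewrite inversion_conj c1.
have [k hk] := reach_inversion_ex hA.
have [k1 h1] := reach_inversion_ex (reach_heis t1 hk).
have [k2 h2] := reach_inversion_ex (reach_heis t2 hk).
exists (maxn k1 k2); rewrite E1 E2 !mulmxA.
by split; [apply: reach_mono h1; rewrite leq_maxl
          |apply: reach_mono h2; rewrite leq_maxr].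
Qed.

Definition pos_letters (w : word knot_gen) := count (fun l => ~~ l.2) w.
Definition neg_letters (w : word knot_gen) := count (fun l => l.2) w.

Lemma reach_word (w : word knot_gen) : exists n,
  reach n (GLmx (weval (rho1_GL R) w)) ((neg_letters w)%:R - (pos_letters w)%:R).
Proof.
elim/last_ind: w => [|w [g b] [n hn]].
  by exists 0; rewrite /weval big_nil subrr; apply: reach_one.
have [m [h1 h2]] := reach_rho1 g hn; exists m.
rewrite -cats1 weval_cat GLmxM /pos_letters /neg_letters !count_cat /=.
rewrite {2}/weval big_seq1 -/(neg_letters w) -/(pos_letters w); case: b => /=.
  by rewrite rho1_invmx !addn0 addn1 -natr1 addrAC.
by rewrite !addn0 addn1 -natr1 opprD addrA.
Qed.

End Paths.
End Cusps.

Local Open Scope classical_set_scope.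
Local Open Scope group_scope.

(** * The abelianization of the knot group *)

Section CommSubgroup.
Variable G : groupType.
Implicit Types (S K : set G) (x y : G).
Local Notation K := (comm_subgroup G).

Lemma generated_subgroup S : is_subgroup (generated S).
Proof.
apply/is_subgroupP; split.
- by move=> H [/is_subgroupP[H1 _ _] _].
- move=> x y Sx Sy H hH; have [/is_subgroupP[_ HM _] _] := hH.
  by apply: HM; [apply: Sx|apply: Sy].
- move=> x Sx H hH; have [/is_subgroupP[_ _ HV] _] := hH.
  by apply: HV; apply: Sx.
Qed.

Lemma comm_in x y : K (comm x y).
Proof. by move=> H [_]; apply; exists x, y. Qed.

Lemma comm_subgroupP : is_subgroup K.
Proof. exact: generated_subgroup. Qed.

Lemma comm_subgroupM x y : K x -> K y -> K (x * y).
Proof. by have /is_subgroupP[_ KM _] := comm_subgroupP; apply: KM. Qed.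

Lemma comm_subgroupJ x y : K x -> K (y * x * y^-1).
Proof.
move=> Kx; have -> : y * x * y^-1 = comm y x * x by rewrite /comm mulgVK.
by apply: comm_subgroupM => //; apply: comm_in.
Qed.

(** Equality in the abelianization, without forming the quotient. *)
Definition comm_eq x y := K (x * y^-1).

Lemma comm_eq_refl x : comm_eq x x.
Proof.
rewrite /comm_eq mulgV.
by have /is_subgroupP[] := comm_subgroupP.
Qed.

Lemma comm_eq_mul x x' y y' :
  comm_eq x y -> comm_eq x' y' -> comm_eq (x * x') (y * y').
Proof.
rewrite /comm_eq => h h'.
have -> : x * x' * (y * y')^-1 = x * (x' * y'^-1) * x^-1 * (x * y^-1).
  by rewrite invgM !mulgA mulgVK.
by apply: comm_subgroupM => //; apply: comm_subgroupJ.
Qed.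

Lemma comm_eq_inv x y : comm_eq x y -> comm_eq x^-1 y^-1.
Proof.
rewrite /comm_eq invgK => h.
have -> : x^-1 * y = x^-1 * (x * y^-1)^-1 * x^-1^-1.
  by rewrite invgM !invgK !mulgA mulgVK.
apply: comm_subgroupJ.
by have /is_subgroupP[_ _ KV] := comm_subgroupP; apply: KV.
Qed.

End CommSubgroup.

(** * Kernels of group homomorphisms *)

Section GenericKernel.
Variables (G H : groupType) (f : {multiplicative G -> H}).

Lemma morph_one : f 1 = 1.
Proof. by apply: (mulgI (f 1)); rewrite -gmulfM !mulg1. Qed.

Lemma morph_inv x : f x^-1 = (f x)^-1.
Proof. by apply: (mulgI (f x)); rewrite -gmulfM !mulgV morph_one. Qed.

Lemma kernel_subgroup : is_subgroup (kernel f).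
Proof.
apply/is_subgroupP; rewrite /kernel /=; split; first exact: morph_one.
- by move=> x y hx hy; rewrite gmulfM hx hy mulg1.
- by move=> x hx; rewrite morph_inv hx invg1.
Qed.

Lemma kernelJ x y : kernel f x -> kernel f (y * x * y^-1).
Proof. by rewrite /kernel /= => hx; rewrite !gmulfM morph_inv hx mulg1 mulgV. Qed.

End GenericKernel.

(** The relation c g_3 = g_1 c makes g_3 a conjugate of g_1. *)
Lemma comm_eq_g3 : comm_eq g3 g1.
Proof.
have := Gamma_relation; set c := comm g3 _ => E.
have -> : g3 = c^-1 * g1 * c by rewrite -mulgA -E mulKg.
by have := comm_in c^-1 g1; rewrite /comm invgK.
Qed.

(** Modulo commutators each letter is g_1 or its inverse, so only the exponent sum of the word
    survives. *)
Lemma comm_eq_word (w : word knot_gen) :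
  comm_eq (pclass _ w : Gamma) (g1 ^+ pos_letters w * g1 ^- neg_letters w).
Proof.
elim: w => [|[g b] w IHw].
  by rewrite /pos_letters /neg_letters /= expg0 invg1 mulg1; apply: comm_eq_refl.
have gE : comm_eq (pclass _ (wgen g) : Gamma) g1.
  by case: g; [exact: comm_eq_refl|exact: comm_eq_g3].
rewrite -(cat1s (g, b)) pclassM /pos_letters /neg_letters /=.
rewrite -/(pos_letters w) -/(neg_letters w).
move: (pos_letters w) (neg_letters w) IHw => p q IHw; case: b => /=.
  have -> : [:: (g, true)] = winv (wgen g) by [].
  have -> : g1 ^+ (0 + p) * g1 ^- (1 + q) = g1^-1 * (g1 ^+ p * g1 ^- q).
    have cV : commute g1^-1 (g1 ^+ p).
      by apply/commute_sym/commuteV/commute_sym/commuteX.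
    by rewrite add0n add1n expgSr invgM mulgA -cV -mulgA.
  by rewrite pclassV; apply: comm_eq_mul => //; apply: comm_eq_inv.
have -> : g1 ^+ (1 + p) * g1 ^- (0 + q) = g1 * (g1 ^+ p * g1 ^- q).
  by rewrite add0n add1n expgS mulgA.
exact: comm_eq_mul.
Qed.

(** * The exponent sum on the kernel *)

Section Kernel.
Variable R : realType.

Lemma rho1_word w : PU21val (rho1 R (pclass _ w)) = proj (weval (rho1_GL R) w).
Proof.
rewrite /= plift_class; elim: w => [|[g b] w IHw].
  by rewrite /weval !big_nil.
rewrite /weval !big_cons projM -/(weval _ w) -/(weval _ w) -IHw /=.
by case: b => //=; rewrite projV.
Qed.

Lemma kernel_exponent w :
  kernel (rho1 R) (pclass _ w) -> pos_letters w = neg_letters w.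
Proof.
move=> /= hw.
have : proj (weval (rho1_GL R) w) = proj 1 by rewrite -rho1_word hw.
(* Being trivial in PGL means being a scalar matrix c, and [reach_scalar] holds for any c. *)
case/projP => c _ E.
have [n] := reach_word R w; rewrite E scalemx1 => /reach_scalar /eqP.
by rewrite subr_eq0 eqr_nat => /eqP.
Qed.

End Kernel.

Theorem corollary7 (R : realType) :
  normal_in (kernel (rho1 R)) (comm_subgroup Gamma).
Proof.
split; [exact: kernel_subgroup|exact: comm_subgroupP| |].
  move=> x; rewrite -[x]pwordK => hx; have := comm_eq_word (pword x).
  by rewrite (kernel_exponent hx) mulgV /comm_eq invg1 mulg1.
by move=> h k _; apply: kernelJ.
Qed.
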